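(* For every non-trivial simple connected graph $G$ of order $n$ (that is, $n\ge 2$), the following facts hold: (i) $1\le \dim_{ms}(G)\le n-1$; (ii) $\dim_{ms}(G)\ge \dim(G)$.
   Context: Graphs are finite, simple and connected; $d_G(u,v)$ is the length of a shortest $u$–$v$ path. For $S=\{w_1,\ldots,w_t\}\subseteq V(G)$ and $u\in V(G)$, the multiset representation of $u$ with respect to $S$ is the multiset $\operatorname{m}(u|S)$ consisting of $d_G(u,w_1),\ldots,d_G(u,w_t)$, counted with multiplicity, and the metric representation of $u$ (with $S$ ordered) is the vector $\operatorname{r}(u|S)=(d_G(u,w_1),\ldots,d_G(u,w_t))$. A set $S$ is an outer multiset resolving set if $\operatorname{m}(u|S)\ne \operatorname{m}(v|S)$ for every two distinct $u,v\in V(G)\setminus S$; the outer multiset dimension $\dim_{ms}(G)$ is the minimum cardinality of such a set. A set $S$ is a resolving set if $\operatorname{r}(u|S)\neq \operatorname{r}(v|S)$ for every two distinct $u,v\in V(G)$; the metric dimension $\dim(G)$ is the minimum cardinality of a resolving set. *)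

(* Defs.v *)
From mathcomp Require Import all_boot finmap multiset.

Set Implicit Arguments.
Unset Strict Implicit.
Unset Printing Implicit Defensive.

(* A finite simple graph is a finType V of vertices with a symmetric and
   irreflexive adjacency relation E. *)

Section Graph.
Variables (V : finType) (E : rel V).

Definition joined_by_path (k : nat) (u v : V) : bool :=
  [exists p : k.-tuple V, [&& path E u p, last u p == v & uniq (u :: p)]].

(* A path repeats no vertex, so its length is less than #|V|; the value of
   gdist is #|V| for vertices that no path joins. *)
Definition gdist (u v : V) : nat :=
  \big[minn/#|V|]_(k < #|V| | joined_by_path k u v) k.

Definition multiset_repr (S : {set V}) (u : V) : {mset nat}%mset :=
  seq_mset [seq gdist u w | w in S].

(* S is ordered by its enumeration. *)
Definition metric_repr (S : {set V}) (u : V) : #|S|.-tuple nat :=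
  [tuple gdist u (enum_val i) | i < #|S|].

Definition outer_multiset_resolving (S : {set V}) : bool :=
  [forall u in ~: S, forall v in ~: S,
     (u != v) ==> (multiset_repr S u != multiset_repr S v)].

Definition resolving (S : {set V}) : bool :=
  [forall u, forall v, (u != v) ==> (metric_repr S u != metric_repr S v)].

(* The set of all vertices satisfies both predicates, so the default value
   #|V| does not alter these minima: see outer_multiset_dim_min and
   metric_dim_min below. *)
Definition outer_multiset_dim : nat :=
  \big[minn/#|V|]_(S : {set V} | outer_multiset_resolving S) #|S|.

Definition metric_dim : nat :=
  \big[minn/#|V|]_(S : {set V} | resolving S) #|S|.

End Graph.

Section Sanity.

Lemma bigminn_le (I : finType) (P : pred I) (F : I -> nat) d i :
  P i -> \big[minn/d]_(j | P j) F j <= F i.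
Proof.
move=> Pi; have : i \in index_enum I by rewrite mem_index_enum.
elim: (index_enum I) => //= a s IHs.
rewrite inE big_cons; case/orP=> [/eqP <-|/IHs H]; first by rewrite Pi geq_minl.
by case: (P a); rewrite // (leq_trans (geq_minr _ _)).
Qed.

Lemma bigminn_attained (I : finType) (P : pred I) (F : I -> nat) d :
  \big[minn/d]_(j | P j) F j = d \/
  exists2 i, P i & \big[minn/d]_(j | P j) F j = F i.
Proof.
elim/big_rec: _ => [|i x Pi [->|[j Pj ->]]]; first by left.
  by rewrite minnC /minn; case: ifP => _; [left | right; exists i].
by right; rewrite /minn; case: ifP => _; [exists i | exists j].
Qed.

Variables (V : finType) (E : rel V).

Lemma gdist_le (u v : V) p : path E u p -> last u p = v -> gdist E u v <= size p.
Proof.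
move=> Ep <-; case/shortenP: Ep => p' Ep' Up' sub.
have lt : size p' < #|V|.
  by have /card_uniqP/= <- := Up'; apply: max_card.
have J : joined_by_path E (Ordinal lt) u (last u p').
  by apply/existsP; exists (in_tuple p'); rewrite /= Ep' eqxx.
apply: leq_trans (bigminn_le (fun k : 'I__ => k : nat) _ J) _.
by case/andP: Up' => _ Up'; apply: uniq_leq_size.
Qed.

Lemma gdist_attained (u v : V) : connect E u v ->
  exists p, [/\ path E u p, last u p = v, uniq (u :: p) & size p = gdist E u v].
Proof.
case/connectP=> p0 Ep0 ->; case/shortenP: Ep0 => p Ep Up _.
have lt : size p < #|V|.
  by have /card_uniqP/= <- := Up; apply: max_card.
have le := gdist_le Ep erefl.
rewrite /gdist in le *.
case: (bigminn_attained (fun k : 'I_#|V| => joined_by_path E k u (last u p))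
         (fun k => k : nat) #|V|) => [eq|[i Ji ->]].
  by rewrite eq leqNgt lt in le.
case/existsP: Ji => q /and3P[Eq /eqP lq Uq].
by exists q; split; rewrite ?size_tuple.
Qed.

Lemma gdist_eq0 (u v : V) : (gdist E u v == 0) = (u == v).
Proof.
apply/eqP/eqP=> [d0|<-]; last first.
  by apply/eqP; rewrite -leqn0 (@gdist_le u u [::]).
have V0 : 0 < #|V| by apply/card_gt0P; exists u.
case: (bigminn_attained (fun k : 'I_#|V| => joined_by_path E k u v)
         (fun k => k : nat) #|V|); rewrite -/(gdist E u v) d0.
  by move=> e; rewrite -e in V0.
case=> i Ji i0; case/existsP: Ji => q /and3P[_ /eqP <- _].
have: size q = 0 by rewrite size_tuple -i0.
by case: (tval q).
Qed.

Lemma outer_multiset_resolvingT : outer_multiset_resolving E [set: V].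
Proof. by apply/forall_inP=> u; rewrite setCT inE. Qed.

Lemma resolvingT : resolving E [set: V].
Proof.
apply/forallP=> u; apply/forallP=> v; apply/implyP; apply: contraNN => /eqP eq.
have uT : u \in [set: V] by rewrite inE.
move/(congr1 (fun t => tnth t (enum_rank_in uT u))): eq.
rewrite !tnth_mktuple enum_rankK_in // => /eqP.
by rewrite (eqP (_ : gdist E u u == 0)) ?gdist_eq0 // eq_sym gdist_eq0 eq_sym.
Qed.

Lemma outer_multiset_dim_min :
  (exists2 S, outer_multiset_resolving E S & outer_multiset_dim E = #|S|) /\
  (forall S, outer_multiset_resolving E S -> outer_multiset_dim E <= #|S|).
Proof.
split=> [|S]; last exact: bigminn_le.
case: (bigminn_attained (outer_multiset_resolving E) (fun S => #|S|) #|V|) => //.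
by move=> eq; exists setT; rewrite ?outer_multiset_resolvingT // cardsT.
Qed.

Lemma metric_dim_min :
  (exists2 S, resolving E S & metric_dim E = #|S|) /\
  (forall S, resolving E S -> metric_dim E <= #|S|).
Proof.
split=> [|S]; last exact: bigminn_le.
case: (bigminn_attained (resolving E) (fun S => #|S|) #|V|) => //.
by move=> eq; exists setT; rewrite ?resolvingT // cardsT.
Qed.

End Sanity.

(* Main.v *)
Require Import Defs.
From mathcomp Require Import all_boot.

(** For (ii), every outer multiset resolving set is resolving
    ([outer_multiset_resolving_resolving]), so a smallest one bounds [metric_dim] from above. For
    (i), the complement of a single vertex is outer multiset resolving, while the empty set is not
    once there are two vertices. *)

Lemma eq_metric_repr {V : finType} {E : rel V} {S : {set V}} {u v : V} :
  metric_repr E S u = metric_repr E S v -> {in S, gdist E u =1 gdist E v}.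
Proof.
(* [enum_rank_in Sw w] is the position of [w] in the enumeration of [S], so this coordinate is the
   distance to [w]. *)
move=> eq_uv w Sw; move/(congr1 (fun t => tnth t (enum_rank_in Sw w))): eq_uv.
by rewrite !tnth_mktuple enum_rankK_in.
Qed.

Lemma metric_repr_inj_in {V : finType} {E : rel V} {S : {set V}} {u v : V} :
  u \in S -> metric_repr E S u = metric_repr E S v -> u = v.
Proof.
move=> Su /eq_metric_repr /(_ u Su) /esym/eqP; have /eqP-> : gdist E u u == 0.
  by rewrite gdist_eq0.
by rewrite gdist_eq0 => /eqP.
Qed.

(** The multiset is the vector with the order of its coordinates forgotten. *)
Lemma metric_repr_multiset_repr {V : finType} {E : rel V} {S : {set V}}
    {u v : V} :
  metric_repr E S u = metric_repr E S v ->
  multiset_repr E S u = multiset_repr E S v.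
Proof.
move=> /eq_metric_repr eq_uv; congr multiset.seq_mset.
by apply/eq_in_map => w; rewrite mem_enum => /eq_uv.
Qed.

(* Vertices of S are told apart by the unique zero coordinate of their metric
   representation, so only pairs outside S matter. *)
Lemma outer_multiset_resolving_resolving {V : finType} {E : rel V}
    {S : {set V}} :
  outer_multiset_resolving E S -> resolving E S.
Proof.
move=> resS; apply/forallP=> u; apply/forallP=> v; apply/implyP=> neq_uv.
apply/eqP=> eq_uv; have [Su|nSu] := boolP (u \in S).
  by rewrite (metric_repr_inj_in Su eq_uv) eqxx in neq_uv.
have [Sv|nSv] := boolP (v \in S).
  by rewrite (metric_repr_inj_in Sv (esym eq_uv)) eqxx in neq_uv.
have /forall_inP/(_ u) := resS; rewrite inE => /(_ nSu)/forall_inP/(_ v).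
rewrite inE => /(_ nSv)/implyP/(_ neq_uv)/eqP; apply.
exact: metric_repr_multiset_repr.
Qed.

(** Only [x] lies outside the set, so there is no pair to separate. *)
Lemma outer_multiset_resolving_setC1 {V : finType} {E : rel V} (x : V) :
  outer_multiset_resolving E [set~ x].
Proof.
apply/forall_inP=> u; rewrite setCK inE => /eqP->.
by apply/forall_inP=> v; rewrite inE => /eqP->; rewrite eqxx.
Qed.

(** With respect to the empty set, all vertices share the empty multiset. *)
Lemma outer_multiset_resolving_set0 {V : finType} {E : rel V} :
  outer_multiset_resolving E set0 -> #|V| <= 1.
Proof.
move=> res0; rewrite leqNgt -cardsT; apply/card_gt1P=> -[u [v [_ _ neq_uv]]].
have /forall_inP/(_ u) := res0; rewrite setC0 inE => /(_ isT)/forall_inP/(_ v).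
rewrite inE => /(_ isT)/implyP/(_ neq_uv).
by rewrite /multiset_repr /image_mem enum_set0 eqxx.
Qed.

Theorem mainTheorem4 (V : finType) (E : rel V) (n : nat)
    (E_sym : symmetric E) (E_irr : irreflexive E)
    (E_conn : forall u v : V, connect E u v)
    (order_n : #|V| = n) (n_ge2 : 2 <= n) :
  (1 <= outer_multiset_dim E <= n - 1) /\
  outer_multiset_dim E >= metric_dim E.
Proof.
have [[S resS dimS] dim_le] := outer_multiset_dim_min E.
have [_ metric_le] := metric_dim_min E.
rewrite dimS; split; last exact/metric_le/outer_multiset_resolving_resolving.
apply/andP; split.
  rewrite card_gt0; apply: contraTneq resS => ->; apply/negP.
  by move/outer_multiset_resolving_set0; rewrite order_n leqNgt n_ge2.
(* Any vertex [x] will do: its complement has [n - 1] elements. *)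
have /card_gt0P[x _] : 0 < #|V| by rewrite order_n ltnW.
rewrite -dimS; apply: leq_trans (dim_le _ (outer_multiset_resolving_setC1 x)) _.
by rewrite cardsC1 order_n subn1.
Qed.
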